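(* Let $\Lambda=\Gamma\times\Phi$, where $\Gamma,\Phi\subset\mathbb{R}^d$ are full-rank lattices. Then $$\Lambda\text{ satisfies }(\mathrm{SG})\iff(\Gamma,\Phi^* )\text{ satisfies }(\mathrm{T}\epsilon\mathrm{P}).$$ If $\Gamma+\Phi^*$ is not discrete, the common condition is $\operatorname{covol}(\Gamma)<\operatorname{covol}(\Phi^* )$, equivalently $\operatorname{covol}(\Lambda)<1$. If $\Gamma+\Phi^*$ is a lattice, then $$\nu(\Lambda)=[\Gamma+\Phi^*:\Phi^*],\qquad \nu(\Lambda^\circ)=[\Gamma+\Phi^*:\Gamma],$$ and the common condition is $$[\Gamma+\Phi^*:\Phi^*]\ge[\Gamma+\Phi^*:\Gamma]+d.$$
   Context: A full-rank lattice in $\mathbb{R}^m$ is $L=M\mathbb{Z}^m$ with $M\in GL_m(\mathbb{R})$, and $\operatorname{covol}(L)=|\det M|$. For a full-rank lattice $L\subset\mathbb{R}^d$, the dual lattice is $L^*=\{\xi\in\mathbb{R}^d:\langle\xi,\ell\rangle\in\mathbb{Z}\text{ for all }\ell\in L\}$. Condition $(\mathrm{T}\epsilon\mathrm{P})$ for a pair $(T,P)$ of full-rank lattices in $\mathbb{R}^d$: $\operatorname{covol}(T)<\operatorname{covol}(P)$ and, if $T+P$ is discrete, then also $[T+P:P]\ge[T+P:T]+d$. Symplectic form on $\mathbb{R}^{2d}=\mathbb{R}^d\times\mathbb{R}^d$: $\sigma((x,\xi),(y,\eta))=\langle\eta,x\rangle-\langle\xi,y\rangle$. For a full-rank lattice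 $\Lambda\subset\mathbb{R}^{2d}$: $\Lambda^\circ=\{z:\sigma(z,\lambda)\in\mathbb{Z}\ \forall\lambda\in\Lambda\}$ (so $(\Lambda^\circ)^\circ=\Lambda$), $\Lambda_{\rm int}=\Lambda\cap\Lambda^\circ$; $\Lambda$ is symplectically rational if $[\Lambda:\Lambda_{\rm int}]<\infty$, and then $\nu(\Lambda)=[\Lambda:\Lambda_{\rm int}]^{1/2}$, $\nu(\Lambda^\circ)=[\Lambda^\circ:\Lambda\cap\Lambda^\circ]^{1/2}$. Condition $(\mathrm{SG})$ for $\Lambda$: $\operatorname{covol}(\Lambda)<1$ and, if $\Lambda$ is symplectically rational, then also $\nu(\Lambda)\ge\nu(\Lambda^\circ)+d$. *)

(* Defs.v *)
From HB Require Import structures.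
From mathcomp Require Import all_boot all_order all_algebra.
From mathcomp Require Import all_classical all_reals all_analysis.
Import Order.TTheory GRing.Theory Num.Theory.
Import numFieldNormedType.Exports.

Set Implicit Arguments.
Unset Strict Implicit.
Unset Printing Implicit Defensive.

Local Open Scope classical_set_scope.
Local Open Scope ring_scope.

(* Vectors of R^m are column vectors; R^d x R^d is 'cV[R]_(d + d), where
   (x, xi) is [col_mx x xi]. *)

Section Lattices.
Context {R : realType}.

Definition dot m (x y : 'cV[R]_m) : R := \sum_(i < m) x i 0 * y i 0.

(* M Z^m *)
Definition lattice_of m (M : 'M[R]_m) : set 'cV[R]_m :=
  [set M *m map_mx intr z | z in [set: 'cV[int]_m]].

Definition lattice_basis m (L : set 'cV[R]_m) (M : 'M[R]_m) : Prop :=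
  M \in unitmx /\ L = lattice_of M.

Definition full_rank_lattice m (L : set 'cV[R]_m) : Prop :=
  exists M, lattice_basis L M.

(* [xget] picks some M in GL_m(R) with L = M Z^m. The choice does not matter:
   two such matrices differ by a factor in GL_m(Z). The default 1%:M is only
   used when L is not a full-rank lattice. *)
Definition covol m (L : set 'cV[R]_m) : R :=
  `| \det (xget 1%:M (lattice_basis L)) |.

Definition dual_lattice m (L : set 'cV[R]_m) : set 'cV[R]_m :=
  [set xi | forall l, L l -> dot xi l \is a Num.int].

Definition add_set m (A B : set 'cV[R]_m) : set 'cV[R]_m :=
  [set x + y | x in A & y in B].

Definition discrete_set m (A : set 'cV[R]_m) : Prop := A `<=` isolated A.

Definition cosets m (A B : set 'cV[R]_m) : set (set 'cV[R]_m) :=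
  [set [set a + b | b in B] | a in A].

(* The index [A : B] of a subgroup B of A, equal to +oo when it is infinite. *)
Definition group_index m (A B : set 'cV[R]_m) : \bar R := counting (cosets A B).

Definition condTeP d (T P : set 'cV[R]_d) : Prop :=
  covol T < covol P /\
  (discrete_set (add_set T P) ->
     (group_index (add_set T P) T + d%:R%:E <= group_index (add_set T P) P)%E).

Definition prod_lattice d (A B : set 'cV[R]_d) : set 'cV[R]_(d + d) :=
  [set col_mx x xi | x in A & xi in B].

(* sigma((x, xi), (y, eta)) = <eta, x> - <xi, y> *)
Definition sympl d (z w : 'cV[R]_(d + d)) : R :=
  dot (dsubmx w) (usubmx z) - dot (dsubmx z) (usubmx w).

Definition adjoint_lattice d (L : set 'cV[R]_(d + d)) : set 'cV[R]_(d + d) :=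
  [set z | forall l, L l -> sympl z l \is a Num.int].

Definition lattice_int d (L : set 'cV[R]_(d + d)) : set 'cV[R]_(d + d) :=
  L `&` adjoint_lattice L.

Definition sympl_rational d (L : set 'cV[R]_(d + d)) : Prop :=
  (group_index L (lattice_int L) < +oo)%E.

(* Since the adjoint is an involution on full-rank lattices,
   [nu (adjoint_lattice L)] is the square root of the index of the intersection
   of L and its adjoint in the adjoint of L. *)
Definition nu d (L : set 'cV[R]_(d + d)) : \bar R :=
  sqrte (group_index L (lattice_int L)).

Definition condSG d (L : set 'cV[R]_(d + d)) : Prop :=
  covol L < 1 /\
  (sympl_rational L -> (nu (adjoint_lattice L) + d%:R%:E <= nu L)%E).

End Lattices.

(* Main.v *)
Require Import Defs.
From HB Require Import structures.
From mathcomp Require Import all_boot all_order all_algebra.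
From mathcomp Require Import all_classical all_reals all_analysis.
From mathcomp Require Import ring lra.
Import Order.TTheory GRing.Theory Num.Theory.
Import numFieldNormedType.Exports.
Local Open Scope classical_set_scope.
Local Open Scope ring_scope.

(** Write Gamma = A Z^d and Phi = B Z^d, so that the dual Phi' of Phi is
    B^-T Z^d, and put N = B^T A.  Multiplication by B^T carries the pair
    (Gamma, Phi') to (N Z^d, Z^d); hence [Gamma + Phi' : Phi'] is the index
    i(N) of Z^d in N Z^d + Z^d, called [lattice_index N] below, and
    exchanging the two lattices gives [Gamma + Phi' : Gamma] = i(N^-1).  Both
    covol(Gamma) < covol(Phi') and covol(Lambda) < 1 mean |det N| < 1.

    On the symplectic side, the adjoint of Lambda = Gamma x Phi is
    Phi' x Gamma', where Gamma' is the dual of Gamma, so that Lambda_int is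
    (Gamma `&` Phi') x (Phi `&` Gamma').  The second isomorphism theorem in
    each factor gives [Lambda : Lambda_int] = i(N) i(N^T)
    ([index_lattice_int]), and the adjoint lattice is again a product, with
    N^-1 in place of N.  The proposition therefore rests on three facts.

    - Gamma + Phi' is discrete iff N is a rational matrix, iff i(N) is finite.
      Both implications towards rationality are pigeonhole arguments on the
      multiples of a column of N modulo Z^d ([discrete_rational],
      [finite_lattice_index_rational]).

    - If N is rational, then i(N^T) = i(N).  The Smith normal form writes N as
      P D Q with P, Q in GL_d(Z) and D diagonal with rational entries q_j;
      neither P nor Q changes the index, and D is its own transpose.  So nu,
      the square root of i(N) i(N^T), is i(N).

    - With the same normal form, i(N) is the product of the denominators of
      the q_j and i(N^-1) that of the absolute values of their numerators.
      Hence i(N^-1) = |det N| i(N) ([rational_lattice_index]), and the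
      inequality i(N^-1) + d <= i(N), where d > 0, forces |det N| < 1: in the
      commensurable case the covolume condition is a consequence of the index
      condition. *)

(** * Counting *)

Lemma counting_card_eq (R : realType) (T U : choiceType) (A : set T) (B : set U) :
  (A #= B)%card -> counting A = counting B :> \bar R.
Proof.
move=> AB; rewrite /counting (eq_finite_set AB).
case: asboolP => // finB; have finA : finite_set A by rewrite (eq_finite_set AB).
by move/(fcard_eq finA finB): AB => ->.
Qed.

Lemma counting_finpred (R : realType) (T : finType) (P : pred T) :
  counting [set` P] = #|P|%:R%:E :> \bar R.
Proof.
rewrite /counting asboolT; last exact: finite_finpred.
rewrite cardE; congr (_%:R%:E); apply/perm_size/uniq_perm.
- exact: finmap.fset_uniq.
- exact: enum_uniq.
- move=> x; rewrite in_fset_set; last exact: finite_finpred.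
  by rewrite mem_enum; apply/idP/idP => [/set_mem|?]; last exact: mem_set.
Qed.

Lemma counting_gt0 (R : realType) (T : choiceType) (A : set T) :
  A !=set0 -> (0 < counting A :> \bar R)%E.
Proof.
move=> [a Aa]; rewrite /counting; case: asboolP => [finA|_]; last by rewrite ltry.
rewrite lte_fin ltr0n finmap.cardfs_gt0; apply/finmap.fset0Pn; exists a.
by rewrite in_fset_set // inE.
Qed.

Lemma counting_setX (R : realType) (T U : choiceType) (A : set T) (B : set U) :
  A !=set0 -> B !=set0 ->
  counting (A `*` B) = (counting A * counting B)%E :> \bar R.
Proof.
move=> A0 B0; have cA := counting_gt0 R _ _ A0; have cB := counting_gt0 R _ _ B0.
have [finA|infA] := pselect (finite_set A); last first.
  have -> : counting A = +oo%E :> \bar R by rewrite /counting asboolF.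
  rewrite gt0_mulye // /counting asboolF // => finAB; apply: infA.
  have -> : A = fst @` (A `*` B).
    apply/seteqP; split=> [x Ax|_ [[x y] [/= Ax _] <-//]].
    by case: B0 => y By; exists (x, y).
  exact: finite_image.
have [finB|infB] := pselect (finite_set B); last first.
  have -> : counting B = +oo%E :> \bar R by rewrite /counting asboolF.
  rewrite gt0_muley // /counting asboolF // => finAB; apply: infB.
  have -> : B = snd @` (A `*` B).
    apply/seteqP; split=> [y By|_ [[x y] [/= _ By] <-//]].
    by case: A0 => x Ax; exists (x, y).
  exact: finite_image.
rewrite /counting !asboolT //; last exact: finite_setX.
rewrite fset_setX // -EFinM -natrM -(size_allpairs pair).
congr (_%:R%:E); apply/perm_size/uniq_perm; first exact: finmap.fset_uniq.
  by apply: allpairs_uniq => [||[? ?] [? ?] _ _ /= [-> ->]//];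
     exact: finmap.fset_uniq.
move=> [x y]; rewrite finmap.in_fsetM; apply/andP/allpairsP => /=.
  by move=> [xA yB]; exists (x, y).
by move=> [[x' y'] [? ? [-> ->]]].
Qed.

Lemma finite_range_repeat (T : Type) (f : nat -> T) :
  finite_set (range f) -> exists i j, (i < j)%N /\ f i = f j.
Proof.
move=> finf; apply: contrapT => nf; apply: infinite_nat.
have -> : [set: nat] = f @^-1` range f by apply/seteqP; split=> // n _; exists n.
apply: finite_preimage => // i j _ _ fij; apply: contrapT => /eqP.
by rewrite neq_ltn => /orP[] lt; apply: nf; [exists i, j | exists j, i].
Qed.

(** * Indices of subgroups *)

Definition subgroup {R : realType} {m : nat} (B : set 'cV[R]_m) : Prop :=
  B 0 /\ forall x y, B x -> B y -> B (x - y).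

Section Index.
Context {R : realType}.

Lemma subgroupN m (B : set 'cV[R]_m) x : subgroup B -> B x -> B (- x).
Proof. by move=> [B0 BB] Bx; rewrite -sub0r; exact: BB. Qed.

Lemma subgroupD m (B : set 'cV[R]_m) x y :
  subgroup B -> B x -> B y -> B (x + y).
Proof.
move=> sB Bx By; rewrite -[y]opprK; case: (sB) => _; apply => //.
exact: subgroupN.
Qed.

Lemma add_set_subgroup m (A B : set 'cV[R]_m) :
  subgroup A -> subgroup B -> subgroup (add_set A B).
Proof.
move=> [A0 AA] [B0 BB]; split; first by exists 0 => //; exists 0 => //; rewrite addr0.
move=> _ _ [a Aa [b Bb <-]] [a' Aa' [b' Bb' <-]].
exists (a - a'); first exact: AA.
by exists (b - b'); [exact: BB | rewrite opprD addrACA].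
Qed.

Lemma setI_subgroup m (A B : set 'cV[R]_m) :
  subgroup A -> subgroup B -> subgroup (A `&` B).
Proof.
by move=> [A0 AA] [B0 BB]; split=> // x y [? ?] [? ?]; split; [exact: AA|exact: BB].
Qed.

Lemma add_setC m (A B : set 'cV[R]_m) : add_set A B = add_set B A.
Proof.
by apply/seteqP; split=> _ [a Aa [b Bb <-]]; exists b => //; exists a => //;
   rewrite addrC.
Qed.

Lemma coset_eqP m (B : set 'cV[R]_m) (x y : 'cV[R]_m) : subgroup B ->
  [set x + b | b in B] = [set y + b | b in B] <-> B (x - y).
Proof.
move=> sB; case: (sB) => B0 BB; split.
  move=> e; have : [set x + b | b in B] x by exists 0 => //; rewrite addr0.
  by rewrite e => -[b Bb <-]; rewrite addrAC subrr add0r.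
move=> Bxy; apply/seteqP; split=> _ [b Bb <-].
  by exists (x - y + b); [exact: subgroupD | rewrite addrA subrKC].
exists (b - (x - y)); first exact: BB.
by rewrite opprB addrCA subrKC addrC.
Qed.

(** Each image is in bijection with the quotient of [A] by the common
    equivalence relation having the same fibers. *)
Lemma card_eq_same_fibers m (T U : Type) (A : set 'cV[R]_m)
    (f : 'cV[R]_m -> T) (g : 'cV[R]_m -> U) :
  (forall x y, A x -> A y -> f x = f y <-> g x = g y) ->
  (f @` A #= g @` A)%card.
Proof.
move=> fg; pose r t := xget 0 [set x | A x /\ f x = t].
have rP x : A x -> A (r (f x)) /\ f (r (f x)) = f x.
  move=> Ax; rewrite /r; case: xgetP => [y -> []//|/(_ x) []]; by split.
have -> : g @` A = (g \o r) @` (f @` A).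
  apply/seteqP; split=> [_ [x Ax <-]|_ [_ [x Ax <-] <-]].
    exists (f x); first by exists x.
    by have [Ar fr] := rP x Ax; exact/fg.
  by have [Ar _] := rP x Ax; exists (r (f x)).
rewrite card_eq_sym; apply: inj_card_eq => _ _ /set_mem[x Ax <-] /set_mem[y Ay <-].
have [Ax' fx] := rP x Ax; have [Ay' fy] := rP y Ay.
by move=> /= /(fg _ _ Ax' Ay'); rewrite fx fy.
Qed.

(** An index can be computed with any invariant that separates the cosets; this
    replaces sets of cosets by more convenient types. *)
Lemma group_index_fibers m (T : choiceType) (A B : set 'cV[R]_m)
    (h : 'cV[R]_m -> T) : subgroup B ->
  (forall x y, A x -> A y -> h x = h y <-> B (x - y)) ->
  group_index A B = counting (h @` A).
Proof.
move=> sB hB; apply/counting_card_eq/card_eq_same_fibers => x y Ax Ay.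
by rewrite coset_eqP // hB.
Qed.

(** [h] induces a bijection from the cosets of [B] in [A] onto the cosets of
    [D] in [C].  Instances are the second isomorphism theorem, with [h] the
    identity, and changes of coordinates, with [h] a multiplication by an
    invertible matrix. *)
Lemma group_index_transport m p (A B : set 'cV[R]_m) (C D : set 'cV[R]_p)
    (h : 'cV[R]_m -> 'cV[R]_p) : subgroup B -> subgroup D ->
  (forall x, A x -> C (h x)) ->
  (forall x y, A x -> A y -> D (h x - h y) <-> B (x - y)) ->
  (forall z, C z -> exists2 x, A x & D (h x - z)) ->
  group_index A B = group_index C D.
Proof.
move=> sB sD hC hD hsurj.
rewrite (@group_index_fibers _ _ A B (fun x => [set h x + b | b in D])) //; last first.
  by move=> x y Ax Ay; rewrite coset_eqP //; exact: hD.
congr counting; apply/seteqP; split=> [_ [x Ax <-]|_ [z Cz <-]].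
  by exists (h x) => //; exact: hC.
by have [x Ax Dx] := hsurj z Cz; exists x => //; apply/coset_eqP.
Qed.

Lemma group_index_add_set m (A B : set 'cV[R]_m) :
  subgroup A -> subgroup B ->
  group_index A (A `&` B) = group_index (add_set A B) B.
Proof.
move=> sA sB; case: (sA) (sB) => A0 AA [B0 BB].
apply: (@group_index_transport _ _ _ _ _ _ id) => //.
- exact: setI_subgroup.
- by move=> x Ax; exists x => //; exists 0 => //; rewrite addr0.
- by move=> x y Ax Ay; split=> [|[]] //; split=> //; exact: AA.
- move=> _ [a Aa [b Bb <-]]; exists a => //.
  by rewrite opprD addrA subrr add0r; exact: subgroupN.
Qed.

Lemma group_index_prod_lattice d (A A' B B' : set 'cV[R]_d) :
  subgroup A -> subgroup A' -> subgroup B -> subgroup B' ->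
  group_index (prod_lattice A B) (prod_lattice A' B') =
  (group_index A A' * group_index B B')%E.
Proof.
move=> sA sA' sB sB'; case: (sA) (sB) => A0 _ [B0 _].
have prodP (X Y : set 'cV[R]_d) z :
    prod_lattice X Y z <-> X (usubmx z) /\ Y (dsubmx z).
  split=> [[x Xx [y Yy <-]]|[Xz Yz]]; first by rewrite col_mxKu col_mxKd.
  by exists (usubmx z) => //; exists (dsubmx z) => //; rewrite vsubmxK.
have sX : subgroup (prod_lattice A' B').
  case: (sA') (sB') => ? AA [? BB].
  split=> [|x y]; rewrite !prodP; first by rewrite !linear0.
  rewrite !linearB.
  by move=> [? ?] [? ?]; split; [exact: AA | exact: BB].
rewrite (@group_index_fibers _ _ _ _ (fun z : 'cV[R]_(d + d) =>
   ([set usubmx z + b | b in A'], [set dsubmx z + b | b in B']))) //; last first.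
  move=> x y _ _; rewrite prodP !linearB -!coset_eqP //.
  by split=> [[-> ->]|[-> ->]].
rewrite /group_index -counting_setX.
- congr counting; apply/seteqP;
    split=> [_ [z /prodP[Az Bz] <-]|[_ _] [/= [x Ax <-] [y By <-]]].
    by split; [exists (usubmx z) | exists (dsubmx z)].
  exists (col_mx x y); first by apply/prodP; rewrite col_mxKu col_mxKd.
  by rewrite col_mxKu col_mxKd.
- by exists [set 0 + b | b in A'], 0.
- by exists [set 0 + b | b in B'], 0.
Qed.

End Index.

(** * Integral matrices and lattices *)

Section IntegralVectors.
Context {R : realType}.

Definition int_mx {m n} (M : 'M[R]_(m, n)) : Prop :=
  forall i j, M i j \is a Num.int.

Lemma int_mx_intr m n (K : 'M[int]_(m, n)) : int_mx (map_mx intr K : 'M[R]_(m, n)).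
Proof. by move=> i j; rewrite mxE intr_int. Qed.

Lemma int_mxP m n (M : 'M[R]_(m, n)) :
  int_mx M -> exists K : 'M[int]_(m, n), M = map_mx intr K.
Proof.
move=> iM; exists (map_mx Num.floor M); apply/matrixP => i j.
by rewrite !mxE floorK //; exact: iM.
Qed.

Lemma int_mx0 m n : int_mx (0 : 'M[R]_(m, n)).
Proof. by move=> i j; rewrite mxE. Qed.

Lemma int_mxN m n (M : 'M[R]_(m, n)) : int_mx M -> int_mx (- M).
Proof. by move=> iM i j; rewrite mxE rpredN; exact: iM. Qed.

Lemma int_mxD m n (M N : 'M[R]_(m, n)) :
  int_mx M -> int_mx N -> int_mx (M + N).
Proof. by move=> iM iN i j; rewrite mxE rpredD. Qed.

Lemma int_mxB m n (M N : 'M[R]_(m, n)) :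
  int_mx M -> int_mx N -> int_mx (M - N).
Proof. by move=> iM iN; apply: int_mxD => //; exact: int_mxN. Qed.

Lemma int_mxM m n p (M : 'M[R]_(m, n)) (N : 'M[R]_(n, p)) :
  int_mx M -> int_mx N -> int_mx (M *m N).
Proof.
move=> iM iN i j; rewrite mxE rpred_sum // => k _.
by rewrite rpredM.
Qed.

Lemma int_mxT m n (M : 'M[R]_(m, n)) : int_mx M -> int_mx M^T.
Proof. by move=> iM i j; rewrite mxE. Qed.

Lemma int_mx_small0 m n (M : 'M[R]_(m, n)) :
  int_mx M -> (forall i j, `|M i j| < 1) -> M = 0.
Proof.
move=> iM sM; apply/matrixP => i j; rewrite mxE; apply/eqP.
have /intrP[k ek] := iM i j; move: (sM i j); rewrite ek -intr_norm ltrz1.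
by rewrite -[1]add0r ltzD1 normr_le0 => /eqP ->.
Qed.

Lemma lattice_ofP m (M : 'M[R]_m) x :
  lattice_of M x <-> exists2 u, int_mx u & x = M *m u.
Proof.
split=> [[z _ <-]|[u /int_mxP[z ->] ->]]; last by exists z.
by exists (map_mx intr z) => //; exact: int_mx_intr.
Qed.

Lemma lattice_of_unitP m (M : 'M[R]_m) x : M \in unitmx ->
  lattice_of M x <-> int_mx (invmx M *m x).
Proof.
move=> uM; rewrite lattice_ofP; split=> [[u iu ->]|iu]; first by rewrite mulKmx.
by exists (invmx M *m x) => //; rewrite mulKVmx.
Qed.

Lemma lattice_of1 m x : lattice_of (1%:M : 'M[R]_m) x <-> int_mx x.
Proof. by rewrite lattice_of_unitP ?unitmx1 // invmx1 mul1mx. Qed.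

Lemma lattice_of_mulr m (M : 'M[R]_m) u : int_mx u -> lattice_of M (M *m u).
Proof. by move=> iu; apply/lattice_ofP; exists u. Qed.

Lemma lattice_of_subgroup m (M : 'M[R]_m) : subgroup (lattice_of M).
Proof.
split; first by rewrite -(mulmx0 _ M); apply: lattice_of_mulr; exact: int_mx0.
move=> _ _ /lattice_ofP[u iu ->] /lattice_ofP[v iv ->]; rewrite -mulmxBr.
by apply: lattice_of_mulr; exact: int_mxB.
Qed.

Lemma lattice_of_subset m (M K : 'M[R]_m) :
  int_mx K -> lattice_of (M *m K) `<=` lattice_of M.
Proof.
move=> iK _ /lattice_ofP[u iu ->]; rewrite -mulmxA.
by apply: lattice_of_mulr; exact: int_mxM.
Qed.

Lemma intr_mx_mulV m (K : 'M[int]_m) : K \in unitmx ->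
  (map_mx intr K : 'M[R]_m) *m map_mx intr (invmx K) = 1%:M.
Proof. by move=> uK; rewrite -map_mxM mulmxV // map_mx1. Qed.

Lemma intr_mx_unit m (K : 'M[int]_m) : K \in unitmx ->
  (map_mx intr K : 'M[R]_m) \in unitmx.
Proof. by move=> uK; case/mulmx1_unit: (intr_mx_mulV m K uK). Qed.

Lemma lattice_of_mul_unit m (M : 'M[R]_m) (K : 'M[int]_m) : K \in unitmx ->
  lattice_of (M *m map_mx intr K) = lattice_of M.
Proof.
move=> uK; apply/seteqP; split; first by apply: lattice_of_subset; exact: int_mx_intr.
rewrite -{1}[M]mulmx1 -(intr_mx_mulV m K uK) mulmxA.
by apply: lattice_of_subset; exact: int_mx_intr.
Qed.

Lemma lattice_col m (M : 'M[R]_m) j : lattice_of M (col j M).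
Proof.
rewrite colE; apply: lattice_of_mulr => i k.
by rewrite mxE; case: (_ && _).
Qed.

Lemma lattice_of_sub_factor m (M N : 'M[R]_m) : M \in unitmx ->
  lattice_of N `<=` lattice_of M -> int_mx (invmx M *m N).
Proof.
move=> uM sub i j; have /(lattice_of_unitP _ _ _ uM)/(_ i 0) :=
  sub _ (lattice_col m N j).
by rewrite colE mulmxA -colE mxE.
Qed.

Lemma int_mx_det m (M : 'M[R]_m) : int_mx M -> \det M \is a Num.int.
Proof. by move=> /int_mxP[K ->]; rewrite det_map_mx intr_int. Qed.

(** The ratio of the two determinants is the determinant of an integral
    invertible matrix, a nonzero integer. *)
Lemma lattice_of_det_ge m (M N : 'M[R]_m) :
  M \in unitmx -> N \in unitmx -> lattice_of N `<=` lattice_of M ->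
  `|\det M| <= `|\det N|.
Proof.
move=> uM uN sub; have iK := lattice_of_sub_factor m M N uM sub.
have -> : N = M *m (invmx M *m N) by rewrite mulKVmx.
rewrite det_mulmx normrM ler_peMr //.
have : \det (invmx M *m N) != 0.
  by rewrite -unitfE -unitmxE unitmx_mul unitmx_inv uM.
have /intrP[k ->] := int_mx_det m _ iK.
by rewrite intr_eq0 -intr_norm ler1z -gtz0_ge1 normr_gt0.
Qed.

(** Two bases generate the same lattice, so that each determinant bounds the
    other one in absolute value. *)
Lemma covol_lattice_of m (M : 'M[R]_m) : M \in unitmx ->
  covol (lattice_of M) = `|\det M|.
Proof.
move=> uM; rewrite /covol; case: xgetP => [N _ [uN e]|/(_ M)[]]; last by split.
have sub x : lattice_of M x <-> lattice_of N x by rewrite e.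
by apply/eqP; rewrite eq_le; apply/andP; split;
   apply: lattice_of_det_ge => // x /sub.
Qed.

Lemma dotE m (x y : 'cV[R]_m) : dot x y = (x^T *m y) 0 0.
Proof. by rewrite mxE; apply: eq_bigr => i _; rewrite mxE. Qed.

Lemma dotC m (x y : 'cV[R]_m) : dot x y = dot y x.
Proof. by apply: eq_bigr => i _; rewrite mulrC. Qed.

(** Pairing with the columns of [M] shows that xi is in the dual iff M^T xi is
    integral. *)
Lemma dual_lattice_of m (M : 'M[R]_m) : M \in unitmx ->
  dual_lattice (lattice_of M) = lattice_of (invmx M^T).
Proof.
move=> uM; apply/seteqP; split=> x.
  move=> dx; apply/lattice_of_unitP; first by rewrite unitmx_inv unitmx_tr.
  rewrite invmxK => i j; rewrite (ord1 j); have := dx _ (lattice_col m M i).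
  by rewrite dotC dotE tr_col -row_mul mxE.
move=> /lattice_ofP[u iu ->] _ /lattice_ofP[v iv ->]; rewrite dotE.
rewrite trmx_mul trmx_inv trmxK -mulmxA mulKmx //.
by apply: int_mxM => //; exact: int_mxT.
Qed.

Lemma prod_lattice_of m (A B : 'M[R]_m) :
  prod_lattice (lattice_of A) (lattice_of B) = lattice_of (block_mx A 0 0 B).
Proof.
have E u v : block_mx A 0 0 B *m col_mx u v = col_mx (A *m u) (B *m v) :> 'cV[R]_(m + m).
  by rewrite mul_block_col !mul0mx addr0 add0r.
apply/seteqP; split=> [_ [_ [u _ <-] [_ [v _ <-] <-]]|_ [w _ <-]].
  by exists (col_mx u v) => //; rewrite map_col_mx E.
rewrite -[w]vsubmxK map_col_mx E.
exists (A *m map_mx intr (usubmx w)); first by exists (usubmx w).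
by exists (B *m map_mx intr (dsubmx w)) => //; exists (dsubmx w).
Qed.

Lemma covol_prod_lattice m (A B : 'M[R]_m) : A \in unitmx -> B \in unitmx ->
  covol (prod_lattice (lattice_of A) (lattice_of B)) = `|\det A| * `|\det B|.
Proof.
move=> uA uB; rewrite prod_lattice_of covol_lattice_of ?det_ublock ?normrM //.
by rewrite unitmxE det_ublock unitrM -!unitmxE uA.
Qed.

(** Testing against (0, b) and (a, 0) separates the two coordinates of an element
    of the adjoint. *)
Lemma adjoint_prod_lattice m (A B : set 'cV[R]_m) : A 0 -> B 0 ->
  adjoint_lattice (prod_lattice A B) = prod_lattice (dual_lattice B) (dual_lattice A).
Proof.
move=> A0 B0; have dot0 (x : 'cV[R]_m) : dot 0 x = 0.
  by rewrite dotE trmx0 mul0mx mxE.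
apply/seteqP; split=> [z dz|_ [x dx [y dy <-]] _ [a Aa [b Bb <-]]].
  exists (usubmx z); last exists (dsubmx z); rewrite ?vsubmxK //.
    move=> b Bb; have := dz (col_mx 0 b); rewrite /sympl col_mxKu col_mxKd.
    by rewrite [dot _ 0]dotC dot0 subr0 dotC; apply; exists 0 => //; exists b.
  move=> a Aa; have := dz (col_mx a 0); rewrite /sympl col_mxKu col_mxKd.
  by rewrite dot0 sub0r rpredN; apply; exists a => //; exists 0.
rewrite /sympl !col_mxKu !col_mxKd rpredB //; last exact: dy.
by rewrite dotC; exact: dx.
Qed.

Lemma prod_lattice_setI m (A B C D : set 'cV[R]_m) :
  prod_lattice A B `&` prod_lattice C D = prod_lattice (A `&` C) (B `&` D).
Proof.
apply/seteqP; split=> [_ [[a Aa [b Bb <-]] [c Cc [d' Dd /eq_col_mx[ac bd]]]]|].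
  by subst c d'; exists a => //; exists b.
by move=> _ [a [Aa Ca] [b [Bb Db] <-]]; split; exists a => //; exists b.
Qed.

End IntegralVectors.

(** * Discreteness, rationality and finite index *)

Section Commensurability.
Context {R : realType}.

Definition rational_mx {m} (N : 'M[R]_m) : Prop :=
  exists2 n : nat, (0 < n)%N & int_mx (n%:R *: N).

Lemma rational_mx_tr m (N : 'M[R]_m) : rational_mx N -> rational_mx N^T.
Proof. by case=> n n0 iN; exists n => //; rewrite -linearZ; exact: int_mxT. Qed.

Lemma rational_mx_cols m (N : 'M[R]_m) :
  (forall j, exists2 n : nat, (0 < n)%N & int_mx (n%:R *: col j N)) ->
  rational_mx N.
Proof.
move=> H; have /choice[n nP] : forall j, exists n : nat,
    (0 < n)%N /\ int_mx (n%:R *: col j N).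
  by move=> j; have [n] := H j; exists n.
exists (\prod_j n j)%N; first by apply: prodn_gt0 => j; case: (nP j).
move=> i j; rewrite (bigD1 j) //= mulnC natrM -scalerA mxE.
have [_ /(_ i 0)] := nP j; rewrite !mxE => ?.
by rewrite rpredM // natr_int.
Qed.

(** Dirichlet's argument: cut the unit cube into boxes of side 1/M < delta; two
    of the multiples of [v] have their fractional parts in the same box. *)
Lemma box_pigeonhole m (v : 'cV[R]_m) (delta : R) : 0 < delta ->
  exists2 n : nat, (0 < n)%N &
    exists2 u, int_mx u & forall i, `|(n%:R *: v - u) i 0| < delta.
Proof.
move=> delta0; pose M := (Num.truncn delta^-1).+1.
have M0 : 0 < M%:R :> R by rewrite ltr0n.
have deltaM : M%:R^-1 < delta.
  by rewrite -[ltRHS]invrK ltf_pV2 ?posrE ?invr_gt0 // truncnS_gt.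
pose fr (n : nat) (i : 'I_m) : R :=
  n%:R * v i 0 - (Num.floor (n%:R * v i 0))%:~R.
have fr0 n i : 0 <= fr n i by rewrite subr_ge0 floor_le_tmp.
have fr1 n i : fr n i < 1 by rewrite ltrBlDl -intrD1 floorD1_gt.
pose box n : {ffun 'I_m -> 'I_M} := [ffun i => inord (Num.truncn (M%:R * fr n i))].
have [n [n' [nn' /ffunP ebox]]] := finite_range_repeat _ box finite_finset.
exists (n' - n)%N; first by rewrite subn_gt0.
exists (\col_i ((Num.floor (n'%:R * v i 0))%:~R - (Num.floor (n%:R * v i 0))%:~R)).
  by move=> i j; rewrite mxE rpredB // intr_int.
move=> i; rewrite !mxE natrB 1?ltnW //.
have -> : (n'%:R - n%:R) * v i 0 -
    ((Num.floor (n'%:R * v i 0))%:~R - (Num.floor (n%:R * v i 0))%:~R)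
  = fr n' i - fr n i.
  by rewrite /fr mulrBl !opprB addrACA [RHS]addrACA; congr (_ + _); rewrite addrC.
have Mfr0 k : 0 <= M%:R * fr k i by rewrite mulr_ge0 // ltW.
have bound k : (Num.truncn (M%:R * fr k i) < M)%N.
  rewrite -(ltr_nat R); apply: le_lt_trans (_ : M%:R * fr k i < _).
    by rewrite truncn_le.
  by rewrite -[ltRHS]mulr1 ltr_pM2l.
have := ebox i; rewrite !ffunE => /(congr1 (@nat_of_ord _)); rewrite !inordK // => et.
apply: lt_trans deltaM; rewrite -(ltr_pM2l M0) mulfV ?gt_eqF //.
rewrite -[X in X * _](gtr0_norm M0) -normrM mulrBr ltr_norml.
have /andP[] := truncn_itv (Mfr0 n'); have /andP[] := truncn_itv (Mfr0 n).
by rewrite et -!natr1; lra.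
Qed.

(** Continuity of [M] at 0, in coordinates. *)
Lemma mulmx_small m (M : 'M[R]_m) (e : R) : 0 < e ->
  exists2 delta : R, 0 < delta &
    forall y : 'cV_m, (forall i, `|y i 0| < delta) -> forall i, `|(M *m y) i 0| < e.
Proof.
move=> e0; pose s := 1 + \sum_i \sum_j `|M i j|.
have s0 : 0 < s.
  by rewrite ltr_pwDl // sumr_ge0 // => i _; rewrite sumr_ge0.
exists (e / s) => [|y sy i]; first by rewrite divr_gt0.
rewrite mxE (le_lt_trans (ler_norm_sum _ _ _)) //.
apply: (@le_lt_trans _ _ (\sum_k `|M i k| * (e / s))).
  by apply: ler_sum => k _; rewrite normrM ler_wpM2l // ltW.
rewrite -mulr_suml mulrCA -[ltRHS]mulr1 ltr_pM2l // ltr_pdivrMr // mul1r.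
rewrite /s ltr_pwDl //.
by rewrite [leRHS](bigD1 i) //= lerDl sumr_ge0 // => k _; rewrite sumr_ge0.
Qed.

(** Close points of [A] have a small difference, whose image by [M] is integral
    with entries less than 1, hence zero. *)
Lemma discrete_of_int_mx m (M : 'M[R]_m) (A : set 'cV[R]_m) : M \in unitmx ->
  (forall x y, A x -> A y -> int_mx (M *m (x - y))) -> discrete_set A.
Proof.
move=> uM iA x Ax; split; first exact: mem_set.
have [delta d0 small] := mulmx_small _ M _ ltr01.
exists (ball x delta); first exact: nbhsx_ballx.
apply/seteqP; split=> [y [[_ xy] Ay]|_ ->]; last by split=> //; exact: ballxx.
have My : M *m (x - y) = 0.
  apply: int_mx_small0 => [|i j]; first exact: iA.
  by rewrite [j]ord1; apply: small => k; have := xy k 0; rewrite !mxE.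
apply/eqP; rewrite eq_sym -subr_eq0; apply/eqP.
by rewrite -[LHS](mulKmx uM) My mulmx0.
Qed.

Lemma discrete_full_rank m (L : set 'cV[R]_m) :
  full_rank_lattice L -> discrete_set L.
Proof.
move=> [M [uM ->]]; apply: (@discrete_of_int_mx _ (invmx M)); rewrite ?unitmx_inv //.
move=> x y /(lattice_of_unitP _ _ _ uM) ix /(lattice_of_unitP _ _ _ uM) iy.
by rewrite mulmxBr; exact: int_mxB.
Qed.

(** The sum is contained in the lattice (1/n) M Z^m, where n N is integral. *)
Lemma rational_discrete m (M N : 'M[R]_m) : M \in unitmx -> rational_mx N ->
  discrete_set (add_set (lattice_of (M *m N)) (lattice_of M)).
Proof.
move=> uM [n n0 iN].
have sub x : add_set (lattice_of (M *m N)) (lattice_of M) x ->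
    int_mx ((n%:R *: invmx M) *m x).
  move=> [_ /lattice_ofP[u iu ->] [_ /lattice_ofP[v iv ->] <-]].
  rewrite -scalemxAl mulmxDr -!mulmxA !mulKmx // scalerDr scalemxAl.
  apply: int_mxD; first exact: int_mxM.
  by move=> i j; rewrite mxE rpredM // natr_int.
apply: (@discrete_of_int_mx _ (n%:R *: invmx M)).
  by rewrite unitmxZ ?unitmx_inv // unitfE pnatr_eq0 -lt0n.
by move=> x y /sub ix /sub iy; rewrite mulmxBr; exact: int_mxB.
Qed.

Lemma discrete_gap m (M : 'M[R]_m) (A : set 'cV[R]_m) : M \in unitmx ->
  A 0 -> discrete_set A -> exists2 delta : R, 0 < delta &
    forall y, A (M *m y) -> (forall i, `|y i 0| < delta) -> y = 0.
Proof.
move=> uM A0 /(_ _ A0)[_ [V /nbhs_ballP[e /= e0 eV] VA]].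
have [delta d0 small] := mulmx_small _ M _ e0; exists delta => // y Ay sy.
rewrite -[LHS](mulKmx uM); suff -> : M *m y = 0 by rewrite mulmx0.
have : (V `&` A) (M *m y); last by rewrite VA.
split=> //; apply: eV; split=> // i j.
by rewrite [j]ord1 /ball /= mxE sub0r normrN; exact: small.
Qed.

Lemma add_lattice_of_mulr m (M N : 'M[R]_m) u v : int_mx u -> int_mx v ->
  add_set (lattice_of (M *m N)) (lattice_of M) (M *m (N *m u + v)).
Proof.
move=> iu iv; rewrite mulmxDr mulmxA; exists (M *m N *m u).
  exact: lattice_of_mulr.
by exists (M *m v) => //; exact: lattice_of_mulr.
Qed.

Lemma int_mx_delta m i : int_mx (delta_mx i 0 : 'cV[R]_m).
Proof. by move=> k j; rewrite mxE; case: (_ && _). Qed.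

Lemma int_mxZn m p (n : nat) (M : 'M[R]_(m, p)) : int_mx M -> int_mx (n%:R *: M).
Proof. by move=> iM i j; rewrite mxE rpredM // natr_int. Qed.

(** A small vector n v - u, with v a column of [N] and u integral, is sent by [M]
    to a point of the sum that is too close to 0 to be different from it;
    hence n v = u is integral. *)
Lemma discrete_rational m (M N : 'M[R]_m) : M \in unitmx ->
  discrete_set (add_set (lattice_of (M *m N)) (lattice_of M)) -> rational_mx N.
Proof.
move=> uM dS; have [|delta d0 gap] := discrete_gap _ _ _ uM _ dS.
  by case: (add_set_subgroup _ _ _ (lattice_of_subgroup m (M *m N))
                              (lattice_of_subgroup m M)).
apply: rational_mx_cols => j.
have [n n0 [u iu small]] := box_pigeonhole _ (col j N) _ d0.
exists n => //; have -> : n%:R *: col j N = u; last by [].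
apply/eqP; rewrite -subr_eq0; apply/eqP/gap => //.
rewrite colE scalemxAr; apply: add_lattice_of_mulr; last exact: int_mxN.
by apply: int_mxZn; exact: int_mx_delta.
Qed.

Definition lattice_index {m} (N : 'M[R]_m) : \bar R :=
  group_index (add_set (lattice_of N) (lattice_of 1%:M)) (lattice_of 1%:M).

(** If there are finitely many cosets of Z^m, two multiples of a column of [N]
    lie in the same one, and a nonzero multiple of this column is integral. *)
Lemma finite_lattice_index_rational m (N : 'M[R]_m) :
  (lattice_index N < +oo)%E -> rational_mx N.
Proof.
rewrite /lattice_index /group_index /counting; case: asboolP => // fin _.
apply: rational_mx_cols => j; have Z1 := lattice_of_subgroup m (1%:M : 'M[R]_m).
pose coset (n : nat) := [set n%:R *: col j N + b | b in lattice_of 1%:M].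
have [|n [n' [nn' /esym/(coset_eqP _ _ _ _ Z1)]]] := finite_range_repeat _ coset.
  apply: sub_finite_set fin => _ [n _ <-]; exists (n%:R *: col j N) => //.
  exists (n%:R *: col j N); last by exists 0; [case: Z1 | rewrite addr0].
  by rewrite colE scalemxAr; apply: lattice_of_mulr; apply: int_mxZn;
     exact: int_mx_delta.
rewrite -scalerBl -natrB 1?ltnW // => /lattice_of1 ?.
by exists (n' - n)%N => //; rewrite subn_gt0.
Qed.

Lemma lattice_index_scale m (M N : 'M[R]_m) : M \in unitmx ->
  group_index (add_set (lattice_of (M *m N)) (lattice_of M)) (lattice_of M) =
  lattice_index N.
Proof.
move=> uM; symmetry; have LM x : lattice_of M (M *m x) <-> lattice_of 1%:M x.
  by rewrite lattice_of1 lattice_of_unitP // mulKmx.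
apply: (@group_index_transport _ _ _ _ _ _ _ (mulmx M)).
- exact: lattice_of_subgroup.
- exact: lattice_of_subgroup.
- move=> _ [_ /lattice_ofP[u iu ->] [v /lattice_of1 iv <-]].
  exact: add_lattice_of_mulr.
- by move=> x y _ _; rewrite -mulmxBr.
- move=> _ [_ /lattice_ofP[u iu ->] [_ /lattice_ofP[v iv ->] <-]].
  exists (N *m u + v).
    by exists (N *m u); [exact: lattice_of_mulr | exists v => //; exact/lattice_of1].
  by rewrite mulmxDr mulmxA subrr; case: (lattice_of_subgroup m M).
Qed.

(** On the right, a unimodular matrix changes the basis of N Z^m; on the left it is
    an automorphism of Z^m. *)
Lemma lattice_index_unimodular m (N : 'M[R]_m) (P Q : 'M[int]_m) :
  P \in unitmx -> Q \in unitmx ->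
  lattice_index (map_mx intr P *m N *m map_mx intr Q) = lattice_index N.
Proof.
move=> uP uQ; rewrite /lattice_index lattice_of_mul_unit //.
rewrite -{1 2}(lattice_of_mul_unit _ 1%:M P uP) mul1mx.
by rewrite lattice_index_scale //; exact: intr_mx_unit.
Qed.

End Commensurability.

(** * The index of a rational matrix by the Smith normal form *)

Section SmithForm.
Context {R : realType}.

Definition diag_rat {m} (q : 'I_m -> rat) : 'M[R]_m := diag_mx (\row_i ratr (q i)).

Lemma diag_rat_mulE m (q : 'I_m -> rat) (u : 'cV[R]_m) i :
  (diag_rat q *m u) i 0 = ratr (q i) * u i 0.
Proof. by rewrite mul_diag_mx !mxE. Qed.

Lemma diag_rat_mulV m (q : 'I_m -> rat) : (forall i, q i != 0) ->
  diag_rat q *m diag_rat (fun i => (q i)^-1) = 1%:M.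
Proof.
move=> q0; rewrite mulmx_diag -diag_const_mx; congr diag_mx.
by apply/rowP => i; rewrite !mxE fmorphV divff // fmorph_eq0.
Qed.

Lemma ratr_denq (q : rat) : (denq q)%:~R * ratr q = (numq q)%:~R :> R.
Proof. by rewrite /ratr mulrC mulfVK // intr_eq0 denq_neq0. Qed.

(** For x and y in (1/b) Z, the residue of b x modulo b is a complete invariant
    of x modulo Z. *)
Lemma eq_mod_floor (b : int) (x y : R) : b != 0 ->
  b%:~R * x \is a Num.int -> b%:~R * y \is a Num.int ->
  (Num.floor (b%:~R * x) = Num.floor (b%:~R * y) %[mod b])%Z <->
  x - y \is a Num.int.
Proof.
move=> b0 /intrP[X eX] /intrP[Y eY]; rewrite eX eY !intrKfloor.
have bR : b%:~R != 0 :> R by rewrite intr_eq0.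
have exy : b%:~R * (x - y) = (X - Y)%:~R by rewrite mulrBr eX eY -intrB.
split=> [/eqP|/intrP[k ek]].
  rewrite eqz_mod_dvd => /dvdzP[k ek].
  suff -> : x - y = k%:~R by exact: intr_int.
  by apply: (mulfI bR); rewrite exy ek intrM mulrC.
apply/eqP; rewrite eqz_mod_dvd; apply/dvdzP; exists k.
by apply: (@intr_inj R); rewrite -exy ek intrM mulrC.
Qed.

(** By Bezout, q Z + Z = (1/b) Z where b is the denominator of q.  So the sum
    splits coordinatewise, and a coset is determined by the residues of b_i x_i
    modulo b_i, which take all values. *)
Lemma lattice_index_diag m (q : 'I_m -> rat) :
  lattice_index (diag_rat q) = (\prod_i `|denq (q i)|)%N%:R%:E.
Proof.
pose b i := denq (q i); have b0 i : b i != 0 := denq_neq0 (q i).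
pose S := add_set (lattice_of (diag_rat q)) (lattice_of (1%:M : 'M[R]_m)).
have ltb i (k : int) : (`|(k %% b i)%Z| < `|b i|)%N.
  by rewrite -ltz_nat gez0_abs ?modz_ge0 // ltz_mod.
pose h (x : 'cV[R]_m) : {dffun forall i, 'I_`|b i|%N} :=
  [ffun i => Ordinal (ltb i (Num.floor ((b i)%:~R * x i 0)))].
have intS x i : S x -> (b i)%:~R * x i 0 \is a Num.int.
  move=> [_ /lattice_ofP[u iu ->] [v /lattice_of1 iv <-]].
  by rewrite mxE diag_rat_mulE mulrDr mulrA ratr_denq rpredD ?rpredM ?intr_int.
rewrite /lattice_index (@group_index_fibers _ _ _ _ _ h); first last.
- move=> x y Sx Sy; rewrite lattice_of1; split.
    move=> /ffunP e i j; rewrite [j]ord1 !mxE.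
    apply/(eq_mod_floor _ _ _ (b0 i)); [exact: intS.. |].
    have := e i; rewrite !ffunE => /(congr1 (@nat_of_ord _)) /= /(congr1 Posz).
    by rewrite !gez0_abs ?modz_ge0.
  move=> ixy; apply/ffunP => i; rewrite !ffunE; apply/val_inj => /=; congr absz.
  by apply/eq_mod_floor => //; [exact: intS.. | have := ixy i 0; rewrite !mxE].
- exact: lattice_of_subgroup.
have -> : h @` S = [set` {dffun forall i, 'I_`|b i|%N}].
  apply/seteqP; split=> // f _.
  pose x : 'cV[R]_m := \col_i ((f i)%:R / (b i)%:~R).
  exists x; last first.
    apply/ffunP => i; rewrite !ffunE; apply/val_inj => /=.
    rewrite mxE mulrC mulfVK ?intr_eq0 // -[_%:R]/((f i : int)%:~R) intrKfloor.
    rewrite modz_small //=.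
    by have := ltn_ord (f i); rewrite -ltz_nat gez0_abs // denq_ge0.
  (* Bezout for the numerator a and the denominator b of q_i: from
     u a + v b = 1 follows f / b = q_i (f u) + f v. *)
  have /choice[uv uvP] i : exists uv : int * int, uv.1 * numq (q i) + uv.2 * b i = 1.
    by apply/coprimezP; exact: coprime_num_den.
  pose u : 'cV[R]_m := \col_i ((f i)%:R * (uv i).1%:~R).
  pose v : 'cV[R]_m := \col_i ((f i)%:R * (uv i).2%:~R).
  exists (diag_rat q *m u).
    by apply: lattice_of_mulr => i j; rewrite mxE rpredM // ?natr_int ?intr_int.
  exists v.
    by apply/lattice_of1 => i j; rewrite mxE rpredM // ?natr_int ?intr_int.
  apply/matrixP => i j; rewrite [j]ord1 mxE diag_rat_mulE !mxE.
  have bR : (b i)%:~R != 0 :> R by rewrite intr_eq0.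
  apply: (mulfI bR); rewrite mulrDr mulrA ratr_denq [RHS]mulrC mulfVK //.
  have := congr1 (intr : int -> R) (uvP i); rewrite intrD !intrM mulr1z => e1.
  by rewrite -[RHS]mulr1 -[X in _ = _ * X]e1; ring.
rewrite counting_finpred card_dep_ffun foldrE big_map big_enum.
by congr (_%:R%:E); apply: eq_bigr => i _; rewrite card_ord.
Qed.

(** This is the Smith normal form of the integral matrix n N, divided by n. *)
Lemma rational_mx_smith m (N : 'M[R]_m) : rational_mx N ->
  exists (P Q : 'M[int]_m) (q : 'I_m -> rat),
    [/\ P \in unitmx, Q \in unitmx &
        N = map_mx intr P *m diag_rat q *m map_mx intr Q].
Proof.
move=> [n n0 /int_mxP[K eK]].
have [P uP [Q uQ [s _ eS]]] := int_Smith_normal_form K.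
exists P, Q, (fun i => (s`_i)%:~R / n%:R); split=> //.
have nR : n%:R != 0 :> R by rewrite pnatr_eq0 -lt0n.
apply: (scalerI nR); rewrite eK eS !map_mxM scalemxAl scalemxAr.
congr (_ *m _ *m _); apply/matrixP => i j; rewrite !mxE -!val_eqE /=.
case: eqP => _; last by rewrite !mulr0n mulr0.
by rewrite !mulr1n fmorph_div /= ratr_int ratr_nat mulrC mulfVK.
Qed.

Lemma denqV (q : rat) : q != 0 -> denq q^-1 = `|numq q|%N.
Proof.
move=> q0; rewrite -{1}[q]divq_num_den invf_div coprimeq_den.
  by rewrite numq_eq0 (negbTE q0).
by rewrite coprime_sym coprime_num_den.
Qed.

Lemma normr_det_intr_unit m (P : 'M[int]_m) : P \in unitmx ->
  `|\det (map_mx intr P : 'M[R]_m)| = 1.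
Proof.
rewrite unitmxE det_map_mx -intr_norm => uP.
by have /orP[/eqP->|/eqP->] : (\det P == 1) || (\det P == -1).
Qed.

(** In the Smith form P D Q of [N], the transpose keeps D and the inverse inverts
    its entries, exchanging numerators and denominators up to sign. *)
Lemma rational_lattice_index m (N : 'M[R]_m) : N \in unitmx -> rational_mx N ->
  exists k l : nat,
    [/\ lattice_index N = k%:R%:E, lattice_index N^T = k%:R%:E,
        lattice_index (invmx N) = l%:R%:E, (0 < k)%N & `|\det N| * k%:R = l%:R].
Proof.
move=> uN rN; have [P [Q [q [uP uQ eN]]]] := rational_mx_smith m N rN.
have detN : `|\det N| = \prod_i `|ratr (q i)|.
  rewrite eN !det_mulmx !normrM !normr_det_intr_unit // mul1r mulr1.
  by rewrite det_diag normr_prod; apply: eq_bigr => i _; rewrite mxE.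
have q0 i : q i != 0.
  apply/eqP => qi0; move: uN; rewrite unitmxE unitfE -normr_eq0 detN.
  by rewrite (bigD1 i) //= qi0 raddf0 normr0 mul0r eqxx.
have eNV : invmx N = map_mx intr (invmx Q) *m diag_rat (fun i => (q i)^-1)
                       *m map_mx intr (invmx P).
  rewrite -[LHS]mulmx1; set X := RHS.
  suff NX : N *m X = 1%:M by rewrite -NX mulKmx.
  rewrite /X eN !mulmxA -[X in X *m _ *m _]mulmxA intr_mx_mulV // mulmx1.
  by rewrite -[X in X *m _]mulmxA diag_rat_mulV // mulmx1 intr_mx_mulV.
exists (\prod_i `|denq (q i)|)%N, (\prod_i `|numq (q i)|)%N; split.
- by rewrite eN lattice_index_unimodular // lattice_index_diag.
- rewrite eN !trmx_mul tr_diag_mx !map_trmx mulmxA.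
  by rewrite lattice_index_unimodular ?unitmx_tr // lattice_index_diag.
- rewrite eNV lattice_index_unimodular ?unitmx_inv // lattice_index_diag.
  by congr (_%:R%:E); apply: eq_bigr => i _; rewrite denqV.
- by apply: prodn_gt0 => i; rewrite absz_gt0 denq_neq0.
- rewrite detN !natr_prod -big_split /=; apply: eq_bigr => i _.
  rewrite !natr_absz !intr_norm -normrM mulrC ratr_denq //.
Qed.

End SmithForm.

(** * Products of lattices *)

Section ProductLattices.
Context {R : realType}.

(** In the basis B^-T of the dual lattice, A Z^m is generated by B^T A. *)
Lemma add_dual_index m (A B : 'M[R]_m) : B \in unitmx ->
  group_index (add_set (lattice_of A) (dual_lattice (lattice_of B)))
              (dual_lattice (lattice_of B)) = lattice_index (B^T *m A).
Proof.
move=> uB; rewrite dual_lattice_of // -{1}[A](@mulKmx _ _ _ B^T) ?unitmx_tr //.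
by rewrite lattice_index_scale // unitmx_inv unitmx_tr.
Qed.

Lemma dual_lattice_of_subgroup m (A : 'M[R]_m) : A \in unitmx ->
  subgroup (dual_lattice (lattice_of A)).
Proof. by move=> uA; rewrite dual_lattice_of //; exact: lattice_of_subgroup. Qed.

Lemma adjoint_prod_lattice_of m (A B : 'M[R]_m) :
  adjoint_lattice (prod_lattice (lattice_of A) (lattice_of B)) =
  prod_lattice (dual_lattice (lattice_of B)) (dual_lattice (lattice_of A)).
Proof.
have [A0 _] := lattice_of_subgroup m A; have [B0 _] := lattice_of_subgroup m B.
exact: adjoint_prod_lattice.
Qed.

Lemma index_lattice_int m (A B : 'M[R]_m) : A \in unitmx -> B \in unitmx ->
  let L := prod_lattice (lattice_of A) (lattice_of B) in
  group_index L (lattice_int L) =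
  (lattice_index (B^T *m A) * lattice_index (B^T *m A)^T)%E.
Proof.
move=> uA uB /=.
have sA := lattice_of_subgroup m A; have sB := lattice_of_subgroup m B.
have sA' := dual_lattice_of_subgroup m A uA.
have sB' := dual_lattice_of_subgroup m B uB.
rewrite /lattice_int adjoint_prod_lattice_of prod_lattice_setI.
rewrite group_index_prod_lattice //; try exact: setI_subgroup.
by rewrite !group_index_add_set // !add_dual_index // trmx_mul trmxK.
Qed.

Lemma nu_prod_lattice m (A B : 'M[R]_m) : A \in unitmx -> B \in unitmx ->
  rational_mx (B^T *m A) ->
  nu (prod_lattice (lattice_of A) (lattice_of B)) = lattice_index (B^T *m A).
Proof.
move=> uA uB rN; rewrite /nu index_lattice_int //.
have uN : B^T *m A \in unitmx by rewrite unitmx_mul unitmx_tr uB.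
have [k [l [-> -> _ _ _]]] := rational_lattice_index m _ uN rN.
by rewrite -expe2 sqrte_sqr gee0_abs // lee_fin.
Qed.

Lemma lattice_index_gt0 m (N : 'M[R]_m) : (0 < lattice_index N)%E.
Proof.
apply: counting_gt0; exists [set 0 + b | b in lattice_of 1%:M], 0 => //.
by case: (add_set_subgroup _ _ _ (lattice_of_subgroup m N) (lattice_of_subgroup m 1%:M)).
Qed.

Lemma sympl_rational_prod_lattice m (A B : 'M[R]_m) : A \in unitmx -> B \in unitmx ->
  sympl_rational (prod_lattice (lattice_of A) (lattice_of B)) <->
  rational_mx (B^T *m A).
Proof.
move=> uA uB; rewrite /sympl_rational index_lattice_int //; split=> [fin|rN].
  apply: finite_lattice_index_rational; move: fin.
  have := lattice_index_gt0 m (B^T *m A)^T; have := lattice_index_gt0 m (B^T *m A).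
  by move=> gt0 gt0T; rewrite !ltey; apply: contra => /eqP ->; rewrite gt0_mulye.
have uN : B^T *m A \in unitmx by rewrite unitmx_mul unitmx_tr uB.
by have [k [l [-> -> _ _ _]]] := rational_lattice_index m _ uN rN; rewrite -EFinM ltry.
Qed.

Lemma discrete_add_dual m (A B : 'M[R]_m) : B \in unitmx ->
  discrete_set (add_set (lattice_of A) (dual_lattice (lattice_of B))) <->
  rational_mx (B^T *m A).
Proof.
move=> uB; rewrite dual_lattice_of // -{1}[A](@mulKmx _ _ _ B^T) ?unitmx_tr //.
have uB' : invmx B^T \in unitmx by rewrite unitmx_inv unitmx_tr.
by split; [exact: discrete_rational | exact: rational_discrete].
Qed.

End ProductLattices.

Theorem proposition1p7 (R : realType) (d : nat) (hd : (0 < d)%N)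
    (Gamma Phi : set 'cV[R]_d)
    (hGamma : full_rank_lattice Gamma) (hPhi : full_rank_lattice Phi) :
  let Lambda := prod_lattice Gamma Phi in
  let Phi' := dual_lattice Phi in
  let S := add_set Gamma Phi' in
  [/\ condSG Lambda <-> condTeP Gamma Phi',
      ~ discrete_set S ->
        [/\ condSG Lambda <-> covol Gamma < covol Phi',
            condTeP Gamma Phi' <-> covol Gamma < covol Phi'
          & covol Gamma < covol Phi' <-> covol Lambda < 1]
    & full_rank_lattice S ->
        [/\ sympl_rational Lambda,
            nu Lambda = group_index S Phi',
            nu (adjoint_lattice Lambda) = group_index S Gamma,
            condSG Lambda <-> (group_index S Gamma + d%:R%:E <= group_index S Phi')%E
          & condTeP Gamma Phi' <->
              (group_index S Gamma + d%:R%:E <= group_index S Phi')%E]].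
Proof.
move=> Lambda Phi' S; move: hGamma hPhi => [A [uA eA]] [B [uB eB]].
pose N := B^T *m A.
have uN : N \in unitmx by rewrite unitmx_mul unitmx_tr uB.
have uA' : invmx A^T \in unitmx by rewrite unitmx_inv unitmx_tr.
have uB' : invmx B^T \in unitmx by rewrite unitmx_inv unitmx_tr.
have eNV : (invmx A^T)^T *m invmx B^T = invmx N.
  have NN : N *m ((invmx A^T)^T *m invmx B^T) = 1%:M.
    by rewrite trmx_inv trmxK /N -mulmxA mulKVmx // mulmxV // unitmx_tr.
  by rewrite -[RHS]mulmx1 -NN mulKmx.
have detN : `|\det N| = `|\det A| * `|\det B| by rewrite det_mulmx det_tr normrM mulrC.
have ePhi' : Phi' = lattice_of (invmx B^T) by rewrite /Phi' eB dual_lattice_of.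
have eGamma' : Gamma = dual_lattice (lattice_of (invmx A^T)).
  by rewrite dual_lattice_of // trmx_inv trmxK invmxK.
have covolLambda : covol Lambda = `|\det N|.
  by rewrite /Lambda eA eB covol_prod_lattice.
have covolP : covol Gamma < covol Phi' <-> covol Lambda < 1.
  rewrite covolLambda ePhi' eA !covol_lattice_of // det_inv det_tr normfV detN.
  by rewrite -ltr_pdivlMr ?div1r // normr_gt0 -unitfE -unitmxE.
have discP : discrete_set S <-> rational_mx N.
  by rewrite /S /Phi' eA eB; exact: discrete_add_dual.
have ratP : sympl_rational Lambda <-> rational_mx N.
  by rewrite /Lambda eA eB; exact: sympl_rational_prod_lattice.
(* Discreteness of the sum does not distinguish its two summands, and exchanging
   their roles replaces N by its inverse. *)
have ratNV : rational_mx N -> rational_mx (invmx N).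
  move=> /discP; rewrite -eNV /S eGamma' ePhi' add_setC.
  by move/discrete_add_dual; exact.
have indexPhi' : group_index S Phi' = lattice_index N.
  by rewrite /S /Phi' eA eB add_dual_index.
have indexGamma : group_index S Gamma = lattice_index (invmx N).
  by rewrite /S add_setC ePhi' eGamma' add_dual_index // eNV.
have nuLambda : rational_mx N -> nu Lambda = group_index S Phi'.
  by move=> rN; rewrite /Lambda eA eB nu_prod_lattice // indexPhi'.
have nuAdjoint : rational_mx N -> nu (adjoint_lattice Lambda) = group_index S Gamma.
  move=> rN; rewrite indexGamma /Lambda eA eB adjoint_prod_lattice_of.
  rewrite !dual_lattice_of //.
  by rewrite nu_prod_lattice // eNV //; exact: ratNV.
have SG_TeP : condSG Lambda <-> condTeP Gamma Phi'.
  split=> -[/covolP c H]; split=> //.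
    by move=> /discP rN; rewrite -nuLambda // -nuAdjoint //; exact/H/ratP.
  by move=> /ratP rN; rewrite nuLambda // nuAdjoint //; exact/H/discP.
split=> //.
  move=> nS; have TeP : condTeP Gamma Phi' <-> covol Gamma < covol Phi'.
    by split=> [[]|c] //; split=> // /nS.
  by split=> //; rewrite SG_TeP.
move=> /discrete_full_rank dS; have rN := proj1 discP dS.
(* The covolume inequality is recovered from i(N^-1) = |det N| i(N): the index
   inequality gives |det N| i(N) + d <= i(N), and d > 0. *)
have TeP : condTeP Gamma Phi' <->
    (group_index S Gamma + d%:R%:E <= group_index S Phi')%E.
  split=> [[_ /(_ dS)]//|le]; split=> //; apply/covolP; rewrite covolLambda.
  move: le; rewrite indexGamma indexPhi'.
  have [k [l [-> _ -> k0 detk]]] := rational_lattice_index d _ uN rN.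
  rewrite -EFinD lee_fin -detk => le.
  have k0' : 0 < k%:R :> R by rewrite ltr0n.
  rewrite -(ltr_pM2r k0') mul1r; apply: lt_le_trans le.
  by rewrite ltrDl ltr0n.
split=> //; [exact/ratP|exact: nuLambda|exact: nuAdjoint|by rewrite SG_TeP].
Qed.
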